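(* Let $(\Omega,\mathcal{A},P_0)$ be a probability space (with $P_0$ countably additive) and let $L$ be a linear space of real bounded random variables on $(\Omega,\mathcal{A},P_0)$, regarded as a linear subspace of $L_\infty=L_\infty(\Omega,\mathcal{A},P_0)$. Let $L_\infty^+=\{X\in L_\infty:X\geq 0\}$. There is an equivalent martingale finitely additive probability (for $L$) if and only if there is a norm-open convex set $U\subset L_\infty$ such that $$L_\infty^+\subset U\cup\{0\}\quad\text{and}\quad (L-L_\infty^+)\cap U=\emptyset.$$ In particular, a necessary condition for the existence of an equivalent martingale finitely additive probability is $$\overline{L-L_\infty^+}\,\cap L_\infty^+=\{0\},$$ where the closure is taken in the norm-topology of $L_\infty$. If $P_0$ is atomic, the condition $\overline{L-L_\infty^+}\,\cap L_\infty^+=\{0\}$ (norm closure) is sufficient as well for the existence of an equivalent martingale finitely additive probability.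
   Context: A finitely additive probability on the $\sigma$-field $\mathcal{A}$ is a map $P:\mathcal{A}\to[0,1]$ with $P(\Omega)=1$ and $P(A\cup B)=P(A)+P(B)$ for disjoint $A,B\in\mathcal{A}$. For such $P$ and a bounded $\mathcal{A}$-measurable $X:\Omega\to\mathbb{R}$, $E_P(X)=\int X\,dP$ is the integral with respect to the finitely additive $P$: it is defined in the obvious way on simple functions and extended by uniform limits (every bounded measurable function is a uniform limit of simple functions). An equivalent martingale finitely additive probability (for $L$) is a finitely additive probability $P$ on $\mathcal{A}$ such that $P\sim P_0$ and $E_P(X)=0$ for each $X\in L$, where $P\sim P_0$ means that, for $A\in\mathcal{A}$, $P(A)=0$ if and only if $P_0(A)=0$. $L_\infty$ consists of (classes modulo $P_0$-a.s. equality of) essentially bounded real random variables, with norm $\lVert X\rVert_\infty=\max\{\text{ess sup}(X),\text{ess sup}(-X)\}$, where $\text{ess sup}(X)=\inf\{a\in\mathbb{R}:P_0(X>a)=0\}$; $X\geq 0$ in $L_\infty$ means $X\geq 0$ $P_0$-a.s. For subsets $U,V$ of a linear space, $U-V=\{u-v:u\in U,\,v\in V\}$. A $P_0$-atom is a set $A\in\mathcal{A}$ with $P_0(A)>0$ and $P_0(\cdot\mid A)\in\{0,1\}$ (i.e. $P_0(B\mid A)\in\{0,1\}$ for all $B\in\mathcal{A}$). $P_0$ is atomic if there is a countable (finite or infinite) partition $A_1,A_2,\ldots$ of $\Omega$ such that $A_n$ is a $P_0$-atom for all $n$. *)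

(* Defs.v *)
From HB Require Import structures.
From mathcomp Require Import all_boot all_order all_algebra finmap.
From mathcomp Require Import all_classical all_reals all_analysis.
From mathcomp Require Import measurable_realfun ess_sup_inf simple_functions.

Set Implicit Arguments.
Unset Strict Implicit.
Unset Printing Implicit Defensive.

Import Order.TTheory GRing.Theory Num.Theory.
Import numFieldNormedType.Exports.

Local Open Scope classical_set_scope.
Local Open Scope ring_scope.

(** mathcomp-analysis provides the type [LspaceType mu p1] of classes modulo
    a.e. equality of measurable functions with finite p-norm, but no algebraic
    or topological structure on it. It is made here a normed module. *)
Section Lspace_normedModType.
Context d (T : measurableType d) (R : realType).
Variables (mu : {measure set T -> \bar R}) (p : \bar R) (p1 : (1 <= p)%E).
Local Notation Lfn := (LfunType mu p1).
Local Notation Lsp := (LspaceType mu p1).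
Implicit Types (f g h : Lfn) (X Y Z : Lsp).

HB.instance Definition _ := gen_eqMixin Lsp.
HB.instance Definition _ := gen_choiceMixin Lsp.

Lemma Lspace_fun_in X : (X : T -> R) \in Lfun mu p.
Proof.
apply/andP; split.
  rewrite inE; exact: (measurable_funPT (repr (X : {mfun_ mu, T >-> measurableTypeR R}))).
by rewrite inE; exact: (@Lebesgue_finite _ _ _ mu p p1 X).
Qed.

Definition Lspace_repr X : Lfn := Lfun_Sub p1 (Lspace_fun_in X).

Lemma Lspace_reprE X : Lspace_repr X = X :> (T -> R).
Proof. by []. Qed.

Lemma Lfun_measurableTypeR f : measurable_fun setT (f : T -> measurableTypeR R).
Proof. exact: (measurable_funPT f). Qed.

Definition Lfun_mfun f : {mfun T >-> measurableTypeR R} :=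
  MeasurableFun.Pack (MeasurableFun.Class
    (isMeasurableFun.Build _ _ _ _ _ (@Lfun_measurableTypeR f))).

Lemma Lfun_mfunE f : Lfun_mfun f = f :> (T -> R).
Proof. by []. Qed.

Definition Lclass_mfun f : {mfun_ mu, T >-> measurableTypeR R} :=
  \pi_({mfun_ mu, T >-> measurableTypeR R})%qT (Lfun_mfun f).

Lemma Lclass_mfunE f : (Lclass_mfun f : T -> R) = f %[ae mu].
Proof.
have /eqmodP/asboolP := reprK (Lclass_mfun f).
exact.
Qed.

Lemma ae_eq_Lnorm (f g : T -> R) : measurable_fun setT f ->
  measurable_fun setT g -> f = g %[ae mu] ->
  'N[mu]_p[EFin \o f]%E = 'N[mu]_p[EFin \o g]%E.
Proof.
move=> mf mg fg; rewrite unlock /Lnorm; case: p p1 => [r r1||//].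
- have mpow (h : T -> R) : measurable_fun setT h ->
      measurable_fun setT (fun x : T => (`|(h x)%:E| `^ r)%E : \bar R).
    move=> mh.
    apply: (@measurableT_comp _ _ _ _ _ _ (fun x : \bar R => x `^ r)%E) => //=.
      exact: measurable_poweR.
    by do 2 apply: measurableT_comp => //.
  congr poweR; apply: ae_eq_integral => //; try exact: mpow.
  by apply: filterS fg => x + _ => /(_ I) /= ->.
- move=> _; case: ifPn => // _; apply: eq_ess_sup.
  by apply: filterS fg => x /(_ I) /= ->.
Qed.

Lemma Lclass_mfun_norm f :
  'N[mu]_p[EFin \o Lclass_mfun f]%E = 'N[mu]_p[EFin \o f]%E.
Proof.
apply: ae_eq_Lnorm (Lclass_mfunE f).
  exact: (measurable_funPT (repr (Lclass_mfun f))).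
exact: (measurable_funPT f).
Qed.

Lemma Lclass_finite_norm f : finite_norm mu p (Lclass_mfun f).
Proof. by rewrite /finite_norm Lclass_mfun_norm; exact: Lfunction_finite. Qed.

Definition Lclass f : Lsp :=
  LebesgueSpace.Pack (LebesgueSpace.Class
    (isFinLebesgue.Build _ _ _ _ _ p1 _ (Lclass_finite_norm f))).

Lemma LclassE f : (Lclass f : T -> R) = f %[ae mu].
Proof. exact: Lclass_mfunE. Qed.

Lemma Lspace_eqP X Y : X = Y <-> (X : T -> R) = Y %[ae mu].
Proof.
split=> [->|]; first exact: ae_eq_refl.
case: X => X [[Xf]]; case: Y => Y [[Yf]] /= XY.
have XYE : X = Y.
  apply/eqP; rewrite -(reprK X) -(reprK Y); apply/eqP/eqmodP/asboolP; exact: XY.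
by subst Y; rewrite (Prop_irrelevance Xf Yf).
Qed.

Lemma Lclass_eqP f g : Lclass f = Lclass g <-> (f : T -> R) = g %[ae mu].
Proof.
rewrite Lspace_eqP; split=> h.
  apply: ae_eq_trans (LclassE g); apply: ae_eq_trans h.
  by apply: ae_eq_sym; exact: LclassE.
apply: ae_eq_trans (LclassE f) _; apply: ae_eq_trans h _.
by apply: ae_eq_sym; exact: LclassE.
Qed.

Lemma Lclass_repr X : Lclass (Lspace_repr X) = X.
Proof. by apply/Lspace_eqP/LclassE. Qed.

Definition Lspace_zero : Lsp := Lclass 0.
Definition Lspace_opp X : Lsp := Lclass (- Lspace_repr X).
Definition Lspace_add X Y : Lsp := Lclass (Lspace_repr X + Lspace_repr Y).
Definition Lspace_scale (a : R) X : Lsp := Lclass (a *: Lspace_repr X).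

Lemma LclassN f : Lspace_opp (Lclass f) = Lclass (- f).
Proof.
apply/Lclass_eqP; apply: filterS (LclassE f) => x /(_ I) fE _.
by rewrite -[LHS]/(- Lclass f x) fE.
Qed.

Lemma LclassD f g : Lspace_add (Lclass f) (Lclass g) = Lclass (f + g).
Proof.
apply/Lclass_eqP; apply: filterS2 (LclassE f) (LclassE g) => x
  /(_ I) fE /(_ I) gE _.
by rewrite -[LHS]/(Lclass f x + Lclass g x) fE gE.
Qed.

Lemma LclassZ a f : Lspace_scale a (Lclass f) = Lclass (a *: f).
Proof.
apply/Lclass_eqP; apply: filterS (LclassE f) => x /(_ I) fE _.
by rewrite -[LHS]/(a * Lclass f x) fE.
Qed.

Lemma Lspace_addA : associative Lspace_add.
Proof.
by move=> X Y Z; rewrite -(Lclass_repr X) -(Lclass_repr Y) -(Lclass_repr Z)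
  !LclassD addrA.
Qed.

Lemma Lspace_addC : commutative Lspace_add.
Proof.
by move=> X Y; rewrite -(Lclass_repr X) -(Lclass_repr Y) !LclassD addrC.
Qed.

Lemma Lspace_add0 : left_id Lspace_zero Lspace_add.
Proof. by move=> X; rewrite -(Lclass_repr X) LclassD add0r. Qed.

Lemma Lspace_addN : left_inverse Lspace_zero Lspace_opp Lspace_add.
Proof. by move=> X; rewrite -(Lclass_repr X) LclassN LclassD addNr. Qed.

HB.instance Definition _ := GRing.isZmodule.Build Lsp
  Lspace_addA Lspace_addC Lspace_add0 Lspace_addN.

Lemma Lspace_scaleA a b X :
  Lspace_scale a (Lspace_scale b X) = Lspace_scale (a * b) X.
Proof. by rewrite -(Lclass_repr X) !LclassZ scalerA. Qed.

Lemma Lspace_scale1 : left_id 1 Lspace_scale.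
Proof. by move=> X; rewrite -(Lclass_repr X) LclassZ scale1r. Qed.

Lemma Lspace_scaleDr : right_distributive Lspace_scale +%R.
Proof.
move=> a X Y; rewrite -(Lclass_repr X) -(Lclass_repr Y) [_ + _]LclassD !LclassZ.
by rewrite [RHS]LclassD scalerDr.
Qed.

Lemma Lspace_scaleDl X : {morph Lspace_scale^~ X : a b / a + b}.
Proof.
by move=> a b; rewrite -(Lclass_repr X) !LclassZ [RHS]LclassD scalerDl.
Qed.

HB.instance Definition _ := GRing.Zmodule_isLmodule.Build R Lsp
  Lspace_scaleA Lspace_scale1 Lspace_scaleDr Lspace_scaleDl.

Definition Lspace_norm X : R := fine 'N[mu]_p[EFin \o X]%E.

Lemma Lspace_normE f : Lspace_norm (Lclass f) = fine 'N[mu]_p[EFin \o f]%E.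
Proof. by rewrite /Lspace_norm Lclass_mfun_norm. Qed.

Lemma Lspace_ler_normD X Y :
  Lspace_norm (X + Y) <= Lspace_norm X + Lspace_norm Y.
Proof.
rewrite -(Lclass_repr X) -(Lclass_repr Y) [_ + _ in leLHS]LclassD !Lspace_normE.
exact: ler_LnormD.
Qed.

Lemma Lspace_normrZ (a : R) X : Lspace_norm (a *: X) = `|a| * Lspace_norm X.
Proof.
rewrite -(Lclass_repr X) [_ *: _]LclassZ !Lspace_normE.
have -> : `|a| = fine `|a|%:E by [].
rewrite -fineM//; first by rewrite -LnormZ.
by rewrite -finite_norm_fine.
Qed.

Lemma Lspace_normr0_eq0 X : Lspace_norm X = 0 -> X = 0.
Proof.
rewrite -(Lclass_repr X) Lspace_normE => /fine_Lnormr_eq0 h.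
exact/Lclass_eqP.
Qed.

HB.instance Definition _ := Lmodule_isNormed.Build R Lsp
  Lspace_ler_normD Lspace_normrZ Lspace_normr0_eq0.

End Lspace_normedModType.


Notation Linfty P := (LspaceType P (leey 1%:E)).

Section Linfty_sets.
Context d (T : measurableType d) (R : realType) (P : probability T R).

(** The norm inherited from the library is the essential supremum of [`|X|]. *)
Lemma Linfty_normE (X : Linfty P) :
  `|X|%:E = maxe (ess_sup P (EFin \o X)) (ess_sup P (EFin \o (\- X))).
Proof.
have -> : `|X| = Lspace_norm X by [].
rewrite -[in LHS](Lclass_repr X) Lspace_normE finite_norm_fine Lspace_reprE.
rewrite unlock /Lnorm /= probability_setT lte01.
apply/eqP; rewrite eq_le ge_max; apply/and3P; split.
- apply/ess_supP.
  apply: filterS2 (ess_sup_ge P (EFin \o X)) (ess_sup_ge P (EFin \o (\- X))).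
  move=> x /= h1 h2; rewrite le_max.
  by case: (ler0P (X x)) => _; rewrite ?h1 ?h2 ?orbT.
- by apply: le_ess_sup; apply: nearW => x /=; rewrite lee_fin ler_norm.
- by apply: le_ess_sup; apply: nearW => x /=; rewrite lee_fin -normrN ler_norm.
Qed.

Definition Linfty_ge0 : set (Linfty P) := [set X | \forall x \ae P, 0 <= X x].

(** [Linfty P] is made of classes of arbitrary measurable representatives, so a
    set of random variables is viewed in [Linfty P] through the classes of its
    elements. *)
Definition Linfty_image (L : set {RV P >-> R}) : set (Linfty P) :=
  [set Y | exists2 X, L X & (Y : T -> R) = X %[ae P]].

End Linfty_sets.
Arguments Linfty_ge0 {d T R} P.

Definition set_sub (V : zmodType) (U W : set V) : set V :=
  [set u - w | u in U & w in W].

(** A finitely additive probability on the sigma-algebra of [T] is a content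
    [P : {content set T -> \bar R}] with [P setT = 1]. *)
Section finitely_additive.
Context d (T : measurableType d) (R : realType).
Local Open Scope ereal_scope.
Import HBSimple.

(** Integral with respect to a finitely additive [P]: the common limit of the
    integrals of the sequences of simple functions converging uniformly to [X].
    When [P setT = 1] and [X] is bounded and measurable, it exists, is finite
    and does not depend on the sequence, see [fa_expectationP]; the default
    value [+oo] is irrelevant in that case. *)
Definition fa_expectation (P : {content set T -> \bar R}) (X : T -> R) :
    \bar R :=
  xget +oo [set e | exists2 s : nat -> {sfun T >-> R},
    {uniform, (fun n => s n : T -> R) @ \oo --> X} &
    sintegral P (s n) @[n --> \oo] --> e].

Definition equiv_martingale_fap (P0 : probability T R)
    (L : set {RV P0 >-> R}) (P : {content set T -> \bar R}) : Prop :=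
  [/\ P setT = 1,
      forall A, measurable A -> P A = 0 <-> P0 A = 0 &
      forall X, L X -> fa_expectation P X = 0].

Definition cond_prob (P0 : probability T R) (B A : set T) : \bar R :=
  P0 (B `&` A) / P0 A.

Definition is_patom (P0 : probability T R) (A : set T) : Prop :=
  [/\ measurable A, 0 < P0 A & forall B, measurable B ->
    cond_prob P0 B A = 0 \/ cond_prob P0 B A = 1].

(** Countable partitions, finite or infinite, are indexed by subsets of [nat]. *)
Definition is_atomic (P0 : probability T R) : Prop :=
  exists (D : set nat) (A : nat -> set T),
    partition D A setT /\ forall n, D n -> is_patom P0 (A n).

End finitely_additive.

Section fa_expectation_theory.
Context d (T : measurableType d) (R : realType).
Variable P : {content set T -> \bar R}.
Local Open Scope ereal_scope.
Import HBSimple.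
Implicit Types s t : {sfun T >-> R}.

Lemma content_sfun_split (A : set T) t : measurable A ->
  P A = \sum_(b <- fset_set (range t)) P (A `&` t @^-1` [set b]).
Proof.
move=> mA.
have UA : \bigcup_(b in range t) (A `&` t @^-1` [set b]) = A.
  rewrite -setI_bigcupr; apply/setIidPl => x _.
  by exists (t x); first by exists x.
rewrite -fsbig_finite; last exact: fimfunP.
rewrite -content_fin_bigcup ?UA//.
by move=> i j _ _ [x [[_ /= <-] [_ /= <-]]].
Qed.

Lemma sintegral_split s t : sintegral P s =
  \sum_(a <- fset_set (range s)) \sum_(b <- fset_set (range t))
    a%:E * P (s @^-1` [set a] `&` t @^-1` [set b]).
Proof.
have -> : sintegral P s =
    \sum_(a \in range s) a%:E * P (s @^-1` [set a]).
  rewrite /sintegral (fsbig_widen (range s) setT)//= => x [_ Nfx] /=.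
  by rewrite preimage10// measure0 mule0.
rewrite fsbig_finite; last exact: fimfunP.
apply: eq_bigr => a _; rewrite (content_sfun_split t)//.
by rewrite ge0_sume_distrr.
Qed.

Hypothesis PT : P setT = 1.

Lemma fin_P A : measurable A -> P A \is a fin_num.
Proof.
move=> mA; rewrite ge0_fin_numE//.
by rewrite (@le_lt_trans _ _ (P setT)) ?PT ?ltry// -PT le_measure ?inE.
Qed.

Lemma sintegral_fin_num s : sintegral P s \is a fin_num.
Proof.
rewrite (sintegral_split s s); apply/sum_fin_numP => a _ _.
by apply/sum_fin_numP => b _ _; rewrite fin_numM// fin_P//; exact: measurableI.
Qed.

Lemma sintegral_leD s t (c : R) : (forall x, s x <= t x + c)%R ->
  sintegral P s <= sintegral P t + c%:E.
Proof.
move=> st; rewrite (sintegral_split s t) (sintegral_split t s) exchange_big/=.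
have -> : c%:E = \sum_(b <- fset_set (range t)) \sum_(a <- fset_set (range s))
    c%:E * P (t @^-1` [set b] `&` s @^-1` [set a]).
  rewrite -[LHS]mule1 -PT (content_sfun_split t)// ge0_sume_distrr//; last first.
  apply: eq_bigr => b _.
  by rewrite (content_sfun_split s (measurableI _ _ _ _)) // setTI ge0_sume_distrr.
rewrite -big_split/=; apply: lee_sum => b _.
rewrite -big_split/=; apply: lee_sum => a _.
rewrite -muleDl//; last first.
  by apply: fin_P; exact: measurableI.
rewrite setIC; have [->|/set0P[x [/= <- <-]]] :=
  eqVneq (t @^-1` [set b] `&` s @^-1` [set a]) set0.
  by rewrite measure0 !mule0.
by rewrite lee_wpmul2r// -EFinD lee_fin.
Qed.

Lemma sintegral_dist s t (c : R) : (forall x, `|s x - t x| <= c)%R ->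
  (`|fine (sintegral P s) - fine (sintegral P t)| <= c)%R.
Proof.
move=> st; rewrite ler_distl lerBlDr -!lee_fin !EFinD.
rewrite !fineK ?sintegral_fin_num//; apply/andP; split.
- apply: sintegral_leD => x; have := st x.
  by rewrite ler_distl lerBlDr => /andP[].
- apply: sintegral_leD => x; have := st x.
  by rewrite ler_distl => /andP[].
Qed.

Lemma cvg_uniformP (f : nat -> T -> R) (X : T -> R) :
  {uniform, f @ \oo --> X} <->
  forall e : R, (0 < e)%R -> \forall n \near \oo, forall x, (`|X x - f n x| < e)%R.
Proof.
split=> [fX e e0|fX B /uniform_nbhs[E [entE EB]]].
  apply: (fX [set g | forall x, `|X x - g x| < e]%R).
  apply/uniform_nbhs; exists [set xy | ball xy.1 e xy.2]; split.
    exact: entourage_ball (PosNum e0).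
  by move=> g /= h x; apply: h.
move: entE; rewrite -entourage_ballE => -[e /= e0 eE].
change (\forall n \near \oo, B (f n)).
apply: filterS (fX e e0) => n fn; apply: EB => x _; apply: eE.
by rewrite /= -ball_normE; exact: fn.
Qed.

Lemma sfun_dense (X : T -> R) : measurable_fun setT X -> bounded_fun X ->
  exists s : nat -> {sfun T >-> R}, {uniform, (fun n => s n : T -> R) @ \oo --> X}.
Proof.
move=> mX [M0 [_ bX]].
have {bX} [M bX] : exists M : nat, forall x, (`|X x| <= M%:R)%R.
  exists (Num.truncn M0).+1 => x; apply: bX => //.
  exact: truncnS_gt.
pose h n (r : R) : R := ((Num.floor (n.+1%:R * r))%:~R / n.+1%:R)%R.
have mh n : measurable_fun setT (h n \o X).
  apply: measurableT_comp mX; apply: nondecreasing_measurable => // x y xy.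
  by rewrite ler_wpM2r ?invr_ge0// ler_int le_floor// ler_wpM2l.
have fh n : finite_set (range (h n \o X)).
  pose K := (n.+1 * M).+1.
  apply: (@sub_finite_set _ _
    ((fun k : nat => ((k%:R - K%:R) / n.+1%:R)%R : R) @` `I_(K + K).+1)); last first.
    exact/finite_image/finite_II.
  move=> _ [x _ <-] /=; rewrite /h.
  set z := Num.floor _.
  have [zK1 zK2] : (- K%:Z <= z /\ z <= K%:Z)%R.
    have : (`|n.+1%:R * X x| <= (n.+1 * M)%:R)%R.
      by rewrite normrM ger0_norm// natrM ler_wpM2l.
    rewrite ler_norml => /andP[y1 y2]; split.
      apply: (@le_trans _ _ (- (n.+1 * M)%N%:Z)%R).
        by rewrite lerN2 /K lez_nat.
      by rewrite floor_ge_int rmorphN.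
    apply: (@le_trans _ _ (n.+1 * M)%N%:Z); last by rewrite /K lez_nat.
    by rewrite -(ler_int R) (le_trans (floor_le _)).
  have zK : (`|(z + K%:Z)%R|%N : int) = (z + K%:Z)%R.
    by rewrite gez0_abs// -lerBlDr sub0r.
  exists `|(z + K%:Z)%R|%N.
    by rewrite /= ltnS -lez_nat zK PoszD lerD2r.
  congr (_ / _)%R.
  by rewrite -[X in (X - _)%R]/((`|(z + K%:Z)%R|%N : int)%:~R)%R zK rmorphD/= addrK.
have hs n : h n \o X \in sfun.
  by apply/andP; split; rewrite inE; [exact: mh|exact: fh].
exists (fun n => sfun_Sub (hs n)); apply/cvg_uniformP => e e0.
near=> n => x; rewrite /= /h.
set y := (n.+1%:R * X x)%R.
have -> : (X x - (Num.floor y)%:~R / n.+1%:R)%R =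
    ((y - (Num.floor y)%:~R) / n.+1%:R)%R.
  by rewrite mulrBl /y [(n.+1%:R * _)%R]mulrC mulfK.
have y1 := floor_le y; have y2 := floorD1_gt y.
rewrite ger0_norm ?divr_ge0 ?subr_ge0//.
apply: (@lt_trans _ _ (n.+1%:R^-1)%R).
  by rewrite ltr_pdivrMr// mulVf// ltrBlDl -[X in (_ + X)%R]/(1%:~R)%R -rmorphD.
near: n; exact: near_infty_natSinv_lt (PosNum e0).
Unshelve. all: by end_near. Qed.

Lemma fa_expectationP (X : T -> R) : measurable_fun setT X -> bounded_fun X ->
  fa_expectation P X \is a fin_num /\
  forall s : nat -> {sfun T >-> R},
    {uniform, (fun n => s n : T -> R) @ \oo --> X} ->
    sintegral P (s n) @[n --> \oo] --> fa_expectation P X.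
Proof.
move=> mX bX.
have near_dist (s t : nat -> {sfun T >-> R}) (e : R) : (0 < e)%R ->
    {uniform, (fun n => s n : T -> R) @ \oo --> X} ->
    {uniform, (fun n => t n : T -> R) @ \oo --> X} ->
    exists N, forall n m, (N <= n)%N -> (N <= m)%N ->
    (`|fine (sintegral P (s n)) - fine (sintegral P (t m))| <= e)%R.
  move=> e0 /cvg_uniformP/(_ _ (divr_gt0 e0 (ltr0n _ 2)))[N _ sN].
  move=> /cvg_uniformP/(_ _ (divr_gt0 e0 (ltr0n _ 2)))[N' _ tN].
  exists (maxn N N') => n m; rewrite !geq_max => /andP[nN _] /andP[_ mN].
  apply: sintegral_dist => x.
  have := sN n nN x; have := tN m mN x => h1 h2.
  rewrite (le_trans (ler_distD (X x) _ _))// (splitr e).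
  by rewrite distrC lerD// ltW.
have [s0 s0X] := sfun_dense mX bX.
have s0c : cvgn (fun n => fine (sintegral P (s0 n))).
  apply: cauchy_cvg; apply: cauchy_exP => e e0.
  have [N sN] := near_dist _ _ _ (divr_gt0 e0 (ltr0n _ 2)) s0X s0X.
  exists (fine (sintegral P (s0 N))); exists N => // n /= Nn.
  rewrite -ball_normE /= (le_lt_trans (sN _ _ _ _))//.
  by rewrite gtr_pMr// invf_lt1// ltr1n.
have lim_s (s : nat -> {sfun T >-> R}) :
    {uniform, (fun n => s n : T -> R) @ \oo --> X} ->
    sintegral P (s n) @[n --> \oo] --> (lim (fine (sintegral P (s0 n)) @[n --> \oo]))%:E.
  move=> sX.
  have -> : (fun n => sintegral P (s n)) =
      (fun n => (fine (sintegral P (s n)))%:E).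
    by apply/funext => n; rewrite fineK// sintegral_fin_num.
  apply: cvg_EFin; first exact: nearW.
  rewrite (_ : fine \o _ = (fun n => fine (sintegral P (s n))))//.
  apply/cvgrPdist_le => e e0.
  have [N sN] := near_dist _ _ _ (divr_gt0 e0 (ltr0n _ 2)) s0X sX.
  move/cvgrPdist_le : s0c => /(_ _ (divr_gt0 e0 (ltr0n _ 2)))[N' _ s0N].
  exists N => // m /= Nm.
  have h1 := s0N (maxn N N') (leq_maxr _ _).
  have h2 := sN (maxn N N') m (leq_maxl _ _) Nm.
  apply: (le_trans (ler_distD (fine (sintegral P (s0 (maxn N N')))) _ _)).
  by rewrite (splitr e) lerD.
have -> : fa_expectation P X = (lim (fine (sintegral P (s0 n)) @[n --> \oo]))%:E.
  rewrite /fa_expectation; case: xgetP => [e _ [s sX se]|/(_ _) noe].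
    by apply: cvg_unique se (lim_s _ sX).
  by exfalso; apply: noe; exists s0 => //; exact: lim_s.
by split => // s sX; exact: lim_s.
Qed.

End fa_expectation_theory.

(* Main.v *)
Require Import Defs.
From HB Require Import structures.
From mathcomp Require Import all_boot all_order all_algebra finmap.
From mathcomp Require Import all_classical all_reals all_analysis.
From mathcomp Require Import measurable_realfun ess_sup_inf simple_functions.
From mathcomp Require Import ring lra.

Set Implicit Arguments.
Unset Strict Implicit.
Unset Printing Implicit Defensive.

Import Order.TTheory GRing.Theory Num.Theory.
Import numFieldNormedType.Exports.

Local Open Scope classical_set_scope.
Local Open Scope ring_scope.

(** The condition on [P] is a condition on the integral against [P]. Sending the
    class of a bounded measurable function to its expectation identifies the
    equivalent martingale finitely additive probabilities, up to normalization,
    with the linear functionals [phi] on [Linfty P0] that are nonnegative on the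
    positive cone, positive on the indicator of each event of positive
    probability and zero on [L] ([equiv_martingale_fap_functional] and
    [martingale_functional_fap]). One direction needs the integral against a
    content to be linear and blind to [P0]-null sets; for the other, a positive
    functional is bounded, so it is determined by its values on simple
    functions. The three assertions are then about functionals.

    Write [K] for the convex cone of differences between [L] and the positive
    cone. A functional as above is at most zero on [K] and positive on each
    nonzero nonnegative class, since such a class dominates a positive multiple
    of an indicator ([Linfty_indic_gt0]). Being bounded, it is continuous, and
    its open half-space [0 < phi] is the required [U]. Conversely, the
    Hahn-Banach theorem separates [U] from [K] ([exists_separating_functional]),
    and a functional at most zero on [K] is nonnegative on the positive cone and
    zero on the linear space [L]. Hahn-Banach is obtained by Zorn's lemma, from
    the fact that a minimal sublinear functional is linear.

    An open [U] disjoint from [K] is disjoint from the closure of [K], which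
    gives the necessary condition. When this condition holds, each indicator of
    an event of positive probability has a ball disjoint from [K], hence a
    functional at most zero on [K] and positive at this indicator. For an atomic
    [P0], applying this to the countably many atoms and summing the normalized
    functionals with weights [2 ^- n] gives a functional positive on every atom;
    an event of positive probability contains an atom up to a null set, so the
    sum is positive on its indicator too. *)

(** * Minimal sublinear functionals and the Hahn-Banach theorem *)

Section sublinear_functionals.
Context (R : realType) (V : lmodType R).
Implicit Types (p q : V -> R) (x y : V).

Definition sublinear p := (forall x y, p (x + y) <= p x + p y) /\
  (forall a x, 0 < a -> p (a *: x) <= a * p x).

Lemma sublinearZ p a x : sublinear p -> 0 < a -> p (a *: x) = a * p x.
Proof.
move=> [_ pZ] a0; apply/eqP; rewrite eq_le pZ//=.
have := pZ a^-1 (a *: x); rewrite invr_gt0 scalerA mulVf ?gt_eqF// scale1r.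
by move=> /(_ a0); rewrite ler_pdivlMl.
Qed.

Lemma sublinear0 p : sublinear p -> p 0 = 0.
Proof.
by move=> /(@sublinearZ _ 2 0)/(_ (ltr0n _ 2)); rewrite scaler0; lra.
Qed.

Lemma sublinear_geN p x : sublinear p -> - p (- x) <= p x.
Proof.
by move=> sp; have := sp.1 x (- x); rewrite subrr sublinear0//; lra.
Qed.

(** The infimum of a chain of sublinear functionals is finite, because each
    member [q] below [p] satisfies [- p (- x) <= q x], and it is sublinear
    because two members of a chain can be compared. *)
Lemma exists_minimal_sublinear p : sublinear p ->
  exists q, [/\ sublinear q, (forall x, q x <= p x) &
    forall q', sublinear q' -> (forall x, q' x <= q x) -> q' = q].
Proof.
move=> sp; pose S := {q | sublinear q /\ forall x, q x <= p x}.
pose le_rev (q r : S) := `[< forall x, sval r x <= sval q x >].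
have [|||A totA|[q [sq qp]] qmax] := @Zorn S le_rev.
- by move=> q; apply/asboolP.
- move=> q r s /asboolP qr /asboolP rs; apply/asboolP => x.
  exact: le_trans (rs x) (qr x).
- move=> [q hq] [r hr] /asboolP/= qr /asboolP/= rq; apply: eq_exist.
  by apply/funext => x; apply/eqP; rewrite eq_le qr rq.
- have [A0|/set0P[q0 Aq0]] := eqVneq A set0.
    by exists (exist _ p (conj sp (fun x => lexx (p x)))) => q; rewrite A0.
  pose E x := [set sval q x | q in A]; pose m x := inf (E x).
  have lbE x : has_lbound (E x).
    exists (- p (- x)) => _ [[q [sq qp]] _ <-] /=.
    by rewrite (le_trans _ (sublinear_geN _ sq))// lerN2.
  have mE (q : S) x : A q -> m x <= sval q x.
    by move=> Aq; apply: ge_inf => //; exists q.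
  have Em x c : (forall q : S, A q -> c <= sval q x) -> c <= m x.
    move=> cE; apply: lb_le_inf; first by exists (sval q0 x), q0.
    by move=> _ [q Aq <-]; exact: cE.
  have sm : sublinear m.
    split=> [x y|a x a0].
      rewrite -lerBlDr; apply: (Em x) => q1 Aq1; rewrite lerBlDr -lerBlDl.
      apply: (Em y) => q2 Aq2; rewrite lerBlDl.
      (* subadditivity of the smaller of [q1] and [q2] gives the bound *)
      have [/asboolP q12|/asboolP q21] := totA _ _ Aq1 Aq2.
        rewrite (le_trans (mE _ _ Aq2))// (le_trans ((svalP q2).1.1 x y))//.
        by rewrite lerD2r q12.
      rewrite (le_trans (mE _ _ Aq1))// (le_trans ((svalP q1).1.1 x y))//.
      by rewrite lerD2l q21.
    rewrite -ler_pdivrMl//; apply: (Em x) => q Aq; rewrite ler_pdivrMl//.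
    by rewrite (le_trans (mE _ _ Aq))//; exact: (svalP q).1.2.
  have mp x : m x <= p x.
    by rewrite (le_trans (mE _ x Aq0))//; exact: (svalP q0).2.
  by exists (exist _ m (conj sm mp)) => q Aq; apply/asboolP => x; exact: mE.
- exists q; split=> // q' sq' q'q.
  have q'p x : q' x <= p x by exact: le_trans (q'q x) (qp x).
  have := qmax (exist _ q' (conj sq' q'p)).
  by move=> /(_ (asboolT q'q)) [].
Qed.

(** The functional [z |-> inf_(t >= 0) (q (z + t y) - t q y)] is sublinear and
    below [q], hence equal to it by minimality; its value at [x] is at most the
    term for [t = 1], which is superadditivity. *)
Lemma minimal_sublinear_add q : sublinear q ->
    (forall q', sublinear q' -> (forall x, q' x <= q x) -> q' = q) ->
  forall x y, q (x + y) = q x + q y.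
Proof.
move=> sq qmin x y; apply/eqP; rewrite eq_le sq.1/=.
pose E z := [set q (z + t *: y) - t * q y | t in [set t | 0 <= t]].
have lbE z : has_lbound (E z).
  exists (- q (- z)) => _ [t /= t0 <-].
  have [->|t_neq0] := eqVneq t 0.
    by rewrite scale0r mul0r addr0 subr0 sublinear_geN.
  have t_gt0 : 0 < t by rewrite lt_neqAle eq_sym t_neq0.
  have := sq.1 (z + t *: y) (- z); rewrite addrAC subrr add0r sublinearZ//; lra.
pose q' z := inf (E z).
have q'E z t : 0 <= t -> q' z <= q (z + t *: y) - t * q y.
  by move=> t0; apply: ge_inf => //; exists t.
have Eq' z c : (forall t, 0 <= t -> c <= q (z + t *: y) - t * q y) -> c <= q' z.
  move=> cE; apply: lb_le_inf.
    by exists (q (z + 0 *: y) - 0 * q y), 0 => /=.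
  by move=> _ [t t0 <-]; exact: cE.
suff q'q : q' = q by have := q'E x 1 ler01; rewrite q'q scale1r mul1r; lra.
apply: qmin => [|z]; last first.
  by have := q'E z 0 (lexx _); rewrite scale0r addr0; lra.
split=> [z w|a z a0].
  rewrite -lerBlDr; apply: (Eq' z) => t t0; rewrite lerBlDr -lerBlDl.
  apply: (Eq' w) => s s0; rewrite lerBlDl.
  rewrite (le_trans (q'E _ (t + s) (addr_ge0 t0 s0)))//.
  by have := sq.1 (z + t *: y) (w + s *: y); rewrite addrACA -scalerDl; lra.
rewrite -ler_pdivrMl//; apply: (Eq' z) => t t0; rewrite ler_pdivrMl//.
rewrite (le_trans (q'E _ (a * t) (mulr_ge0 (ltW a0) t0)))//.
by rewrite -scalerA -scalerDr sublinearZ//; lra.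
Qed.

Lemma scale_functional (a : R) (phi : {scalar V}) :
  exists psi : {scalar V}, forall x, psi x = a * phi x.
Proof.
have plin : linear_for *%R (fun x => a * phi x).
  by move=> b x y; rewrite linearP mulrDr mulrCA.
pose pL := GRing.isLinear.Build _ _ _ _ _ plin.
pose psi : {scalar V} := HB.pack (fun x : V => a * phi x) pL.
by exists psi.
Qed.

End sublinear_functionals.

(** The Hahn-Banach theorem, in the form that starts from the zero subspace. *)
Lemma exists_linear_below (R : realType) (V : lmodType R) (p : V -> R) :
  sublinear p -> exists phi : {scalar V}, forall x, phi x <= p x.
Proof.
move=> /exists_minimal_sublinear[q [sq qp qmin]].
have qD := minimal_sublinear_add sq qmin.
have qN x : q (- x) = - q x.
  by apply/eqP; rewrite -addr_eq0 addrC -qD subrr sublinear0.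
have qlin : linear_for *%R q.
  move=> a x y; rewrite qD; congr (_ + _).
  have [a0|a0|->] := ltgtP a 0; last by rewrite scale0r mul0r sublinear0.
    rewrite -[in LHS](opprK a) scaleNr qN sublinearZ// ?oppr_gt0//.
    by rewrite mulNr opprK.
  exact: sublinearZ.
pose qL := GRing.isLinear.Build _ _ _ _ q qlin.
pose phi : {scalar V} := HB.pack q qL.
by exists phi.
Qed.

Section separation.
Context (R : realType) (V : normedModType R).
Implicit Types (U K : set V).

Definition convex_cone K := [/\ K 0, (forall x y, K x -> K y -> K (x + y)) &
  (forall (a : R) x, 0 < a -> K x -> K (a *: x))].

Lemma open_sub_scale U u x : open U -> U u ->
  exists2 e : R, 0 < e & U (u - e *: x).
Proof.
move=> oU Uu; have /nbhs_ballP[r /= r0 rU] := open_nbhs_nbhs (conj oU Uu).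
have x1 : 0 < `|x| + 1 by rewrite ltr_wpDl.
exists (r / (`|x| + 1)); first by rewrite divr_gt0.
apply: rU; rewrite -ball_normE /= opprB addrC subrK normrZ.
rewrite gtr0_norm ?divr_gt0// mulrAC ltr_pdivrMr// ltr_pM2l//.
by rewrite ltrDl.
Qed.

Lemma convex_setP U : convex_set U <->
  forall x y (a b : R), 0 < a -> 0 < b -> a + b = 1 -> U x -> U y ->
    U (a *: x + b *: y).
Proof.
rewrite convex_setW; split=> [cU x y a b a0 b0 ab Ux Uy|cU x y Ux Uy k k0 k1].
  have a1 : a <= 1 by rewrite -ab lerDl ltW.
  have -> : b = 1 - a by rewrite -ab addrAC subrr add0r.
  have a_lt1 : a < 1 by rewrite -ab ltrDl.
  have := cU x y (mem_set Ux) (mem_set Uy) (Itv01 (ltW a0) a1) a0 a_lt1.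
  exact: set_mem.
have kE : k%:num + (1 - k%:num) = 1 by rewrite addrCA subrr addr0.
apply/mem_set/(cU _ _ _ _ k0 _ kE); try exact: set_mem.
by rewrite subr_gt0.
Qed.

Lemma convex_set_ball (x : V) (r : R) : convex_set (ball x r).
Proof.
apply/convex_setP => y z a b a0 b0 ab; rewrite -!ball_normE /= => xy xz.
rewrite -[x in x - _]scale1r -ab scalerDl opprD addrACA -!scalerBr.
rewrite (le_lt_trans (ler_normD _ _))// !normrZ !gtr0_norm//.
by rewrite -[r]mul1r -ab mulrDl ltrD// ltr_pM2l.
Qed.

(** Let [C] be the cone spanned by the differences between [U] and [K]. It does
    not contain zero, and it contains [u0 - e x] for every [x] and some [e > 0],
    since [U] is open. Hence [p x = inf {t | t u0 - x \in C}] is finite and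
    sublinear. A linear functional below [p] works: [p (- x) < 0] on [U], and
    [p x <= e] on [K] for all [e > 0]. *)
Lemma exists_separating_functional U K :
    open U -> convex_set U -> convex_cone K ->
    U !=set0 -> U `&` K = set0 ->
  exists phi : {scalar V},
    (forall x, U x -> 0 < phi x) /\ (forall x, K x -> phi x <= 0).
Proof.
move=> oU /convex_setP cU [K0 KD KZ] [u0 Uu0] UK0.
pose C := [set x | exists (t : R) u k, [/\ 0 < t, U u, K k & x = t *: u - k]].
have UC u : U u -> C u by move=> Uu; exists 1, u, 0; rewrite scale1r subr0.
have CK x k : C x -> K k -> C (x - k).
  move=> [t [u [k' [t0 Uu Kk' ->]]]] Kk; exists t, u, (k' + k).
  by rewrite opprD addrA; split=> //; exact: KD.
have CZ (a : R) x : 0 < a -> C x -> C (a *: x).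
  move=> a0 [t [u [k [t0 Uu Kk ->]]]]; exists (a * t), u, (a *: k).
  by rewrite scalerBr scalerA; split=> //; [exact: mulr_gt0|exact: KZ].
have CD x y : C x -> C y -> C (x + y).
  move=> [t [u [k [t0 Uu Kk ->]]]] [s [v [l [s0 Uv Kl ->]]]].
  have ts0 : 0 < t + s by rewrite addr_gt0.
  exists (t + s), ((t / (t + s)) *: u + (s / (t + s)) *: v), (k + l).
  split=> //; last 2 first.
  - exact: KD.
  - rewrite scalerDr !scalerA ![(t + s) * _]mulrC !divfK ?gt_eqF//.
    by rewrite addrACA opprD.
  by apply: cU => //; rewrite ?divr_gt0// -mulrDl divff// gt_eqF.
have C0 : ~ C 0.
  move=> [t [u [k [t0 Uu Kk /eqP]]]]; rewrite eq_sym subr_eq0 => /eqP tuk.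
  have : (U `&` K) u.
    split=> //; rewrite -[u]scale1r -(mulVf (lt0r_neq0 t0)) -scalerA tuk.
    by apply: KZ => //; rewrite invr_gt0.
  by rewrite UK0.
have Cpos (t : R) : C (t *: u0) -> 0 < t.
  move=> Ct; rewrite ltNge; apply/negP; rewrite le_eqVlt => /predU1P[t0|t0].
    by apply: C0; rewrite t0 scale0r in Ct.
  apply: C0; have := CD _ _ Ct (CZ (- t) u0 _ (UC _ Uu0)).
  by rewrite scaleNr subrr oppr_gt0; exact.
pose E x := [set t : R | C (t *: u0 - x)]; pose p x := inf (E x).
have Ene x : E x !=set0.
  have [e e0 Ue] := open_sub_scale x oU Uu0.
  exists e^-1; have := CZ e^-1 _ _ (UC _ Ue).
  rewrite invr_gt0 => /(_ e0).
  by rewrite scalerBr scalerA mulVf ?gt_eqF// scale1r.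
have lbE x : has_lbound (E x).
  have [s Es] := Ene (- x); exists (- s) => t Et.
  rewrite -subr_ge0 opprK ltW// Cpos// scalerDl.
  by have := CD _ _ Et Es; rewrite opprK addrACA addNr addr0.
have pE x t : C (t *: u0 - x) -> p x <= t by move=> Ct; exact: ge_inf.
have Ep x c : (forall t, C (t *: u0 - x) -> c <= t) -> c <= p x.
  by move=> cE; exact: lb_le_inf.
have sp : sublinear p.
  split=> [x y|a x a0].
    rewrite -lerBlDr; apply: (Ep x) => t Ct; rewrite lerBlDr -lerBlDl.
    apply: (Ep y) => s Cs; rewrite lerBlDl pE//.
    by rewrite scalerDl opprD addrACA; exact: CD.
  rewrite -ler_pdivrMl//; apply: (Ep x) => t Ct; rewrite ler_pdivrMl// pE//.
  by rewrite -scalerA -scalerBr; exact: CZ.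
have [phi phip] := exists_linear_below sp; exists phi; split=> x xP.
  have [e e0 Ue] := open_sub_scale u0 oU xP.
  have : p (- x) <= - e by apply: pE; rewrite scaleNr opprK addrC; exact: UC.
  by move=> /(le_trans (phip _)); rewrite linearN; lra.
apply/ler_addgt0Pl => e e0; rewrite addr0 (le_trans (phip _))// pE//.
by apply: CK => //; apply: CZ => //; exact: UC.
Qed.

End separation.

(** * Expectation with respect to a finitely additive probability *)

Section bounded_measurable.
Context d (T : measurableType d) (R : realType).
Import HBSimple.
Implicit Types (f g : T -> R) (A : set T).

Definition bounded_mfun f := measurable_fun setT f /\ bounded_fun f.

Lemma bounded_fun_normP f : bounded_fun f <-> exists M, forall x, `|f x| <= M.
Proof.
split=> [[M [_ fM]]|[M fM]].
  by exists (M + 1) => x; apply: fM => //; rewrite ltrDl.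
exists M; split=> [|N MN x _]; rewrite ?num_real//.
exact: le_trans (fM x) (ltW MN).
Qed.

Lemma bounded_mfun_lin (a : R) f g : bounded_mfun f -> bounded_mfun g ->
  bounded_mfun (fun x => a * f x + g x).
Proof.
move=> [mf /bounded_fun_normP[M fM]] [mg /bounded_fun_normP[N gN]]; split.
  by apply: measurable_funD => //; exact: measurable_funM.
apply/bounded_fun_normP; exists (`|a| * M + N) => x.
by rewrite (le_trans (ler_normD _ _))// normrM lerD// ler_wpM2l.
Qed.

Lemma bounded_mfun_sfun (s : {sfun T >-> R}) : bounded_mfun s.
Proof. by split=> //; exact: simple_bounded. Qed.

Lemma bounded_mfun_indic A : measurable A -> bounded_mfun \1_A.
Proof. by move=> mA; exact: (bounded_mfun_sfun (indic_sfun _ mA)). Qed.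

Lemma bounded_mfun_cst (c : R) : bounded_mfun (cst c).
Proof. exact: (bounded_mfun_sfun (cst_sfun c)). Qed.

End bounded_measurable.

Section content_expectation.
Context d (T : measurableType d) (R : realType) (P : {content set T -> \bar R}).
Hypothesis PT : P setT = 1%E.
Import HBSimple.
Implicit Types (s t u : {sfun T >-> R}) (X Y : T -> R).

(** The level sets of [u] can be cut along those of [s] and [t], on which [u] is
    constant. With all integrals expressed on this common partition, linearity
    is that of finite sums. *)
Lemma sintegral_comb (g : R -> R -> R) s t u :
    (forall x, u x = g (s x) (t x)) ->
  sintegral P u = (\sum_(a <- fset_set (range s)) \sum_(b <- fset_set (range t))
    g a b * fine (P (s @^-1` [set a] `&` t @^-1` [set b])))%:E.
Proof.
move=> ug; rewrite (sintegral_split P u s) exchange_big/= -sumEFin.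
apply: eq_bigr => a _.
under eq_bigr => c _.
  rewrite (content_sfun_split P t); last exact: measurableI.
  rewrite ge0_sume_distrr//; over.
rewrite exchange_big/= -sumEFin; apply: eq_bigr => b _.
have mab : measurable (s @^-1` [set a] `&` t @^-1` [set b]).
  exact: measurableI.
rewrite EFinM fineK ?fin_P// (content_sfun_split P u mab) ge0_sume_distrr//.
apply: eq_bigr => c _.
have [e|/set0P[x [[/= <- <-] <-]]] :=
    eqVneq ((u @^-1` [set c] `&` s @^-1` [set a]) `&` t @^-1` [set b]) set0.
  by rewrite [in RHS]setIC setIA e measure0 !mule0.
by rewrite ug [in RHS]setIC setIA.
Qed.

Lemma sintegral_lin (a : R) s t u : (forall x, u x = a * s x + t x) ->
  fine (sintegral P u) = a * fine (sintegral P s) + fine (sintegral P t).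
Proof.
move=> uE; rewrite (@sintegral_comb (fun x y => a * x + y) s t)//.
rewrite (@sintegral_comb (fun x _ => x) s t s)//.
rewrite (@sintegral_comb (fun _ y => y) s t t)//= mulr_sumr -big_split/=.
apply: eq_bigr => x _; rewrite mulr_sumr -big_split/=.
by apply: eq_bigr => y _; rewrite mulrDl mulrA.
Qed.

Lemma sintegral_content_indic (A : set T) : sintegral P \1_A = P A.
Proof.
rewrite sintegralET -(fsbig_widen [set 0%R; 1%R])//=; last first.
  move=> t [_ /= t01]; rewrite preimage10 ?measure0 ?mule0//= => -[x _ xt].
  by apply: t01; rewrite -xt indicE; case: (_ \in _); [right|left].
have N01 : (0 <> 1 :> R)%R by apply/eqP; rewrite eq_sym oner_eq0.
rewrite fsbigU//=; last by move=> t [->].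
rewrite !fsbig_set1 mul0e add0e mul1e.
by rewrite preimage_indic ifT ?inE// ifN ?notin_setE.
Qed.

Lemma cvg_sfun X : bounded_mfun X ->
  exists s : nat -> {sfun T >-> R},
    (forall e : R, 0 < e ->
      \forall n \near \oo, forall x, `|X x - s n x| < e) /\
    fine (sintegral P (s n)) @[n --> \oo] --> fine (fa_expectation P X).
Proof.
move=> bX; have [s sX] := sfun_dense bX.1 bX.2; exists s; split.
  exact/cvg_uniformP.
have [EXfin /(_ s sX)] := fa_expectationP PT bX.1 bX.2.
by rewrite -{1}(fineK EXfin) => /fine_cvg.
Qed.

Lemma cvg_sfun_unique X (s : nat -> {sfun T >-> R}) l :
  bounded_mfun X ->
  (forall e : R, 0 < e -> \forall n \near \oo, forall x, `|X x - s n x| < e) ->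
  fine (sintegral P (s n)) @[n --> \oo] --> l ->
  fa_expectation P X = l%:E.
Proof.
move=> bX sX sl; have [EXfin /(_ s)] := fa_expectationP PT bX.1 bX.2.
have sXu : {uniform, (fun n => s n : T -> R) @ \oo --> X} by exact/cvg_uniformP.
move=> /(_ sXu); rewrite -{1}(fineK EXfin) => /fine_cvg sE.
by rewrite -(fineK EXfin); congr EFin; exact: cvg_unique sE sl.
Qed.

Lemma fa_expectation_lin (a : R) X Y :
  bounded_mfun X -> bounded_mfun Y ->
  fine (fa_expectation P (fun x => a * X x + Y x)) =
  a * fine (fa_expectation P X) + fine (fa_expectation P Y).
Proof.
move=> bX bY.
have [s [sX sEX]] := cvg_sfun bX; have [t [tY tEY]] := cvg_sfun bY.
have bZ := bounded_mfun_lin a bX bY.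
pose u n : {sfun T >-> R} := (cst_sfun a : {sfun T >-> R}) * s n + t n.
have uE n x : u n x = a * s n x + t n x by [].
rewrite (@cvg_sfun_unique _ u
  (a * fine (fa_expectation P X) + fine (fa_expectation P Y)))//.
  move=> e e0; have a1 : 0 < `|a| + 1 by rewrite ltr_wpDl.
  have e1 : 0 < e / 2 / (`|a| + 1) by rewrite !divr_gt0.
  have e2 : 0 < e / 2 by rewrite divr_gt0.
  apply: filterS2 (sX _ e1) (tY _ e2) => n sn tn x; rewrite uE.
  rewrite (_ : _ - _ = a * (X x - s n x) + (Y x - t n x)); last by ring.
  rewrite (le_lt_trans (ler_normD _ _))// normrM (splitr e) ler_ltD//.
  have := sn x; rewrite ltr_pdivlMr// => /ltW; apply: le_trans.
  by rewrite mulrC ler_wpM2l// lerDl.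
under eq_fun do rewrite (sintegral_lin (uE _)).
by apply: cvgD => //; apply: cvgMr.
Qed.

Lemma fa_expectation_ge0 X : bounded_mfun X ->
  (forall x, 0 <= X x) -> 0 <= fine (fa_expectation P X).
Proof.
move=> bX X0; have [s [sX sEX]] := cvg_sfun bX.
apply/ler_addgt0Pl => e e0; rewrite addrC -lerBlDr sub0r.
apply: (closed_cvg (>= - e)) sEX; first exact: closed_ge.
apply: filterS (sX _ e0) => n sn /=.
pose s0 : {sfun T >-> R} := indic_sfun _ measurable0.
have z : (sintegral P s0 <= sintegral P (s n) + e%:E)%E.
  apply: sintegral_leD => // x.
  rewrite -[leLHS]/(\1_set0 x) indicE in_set0 mulr0n.
  by have := sn x; have := X0 x; rewrite ltr_norml => + /andP[]; lra.
move: z; rewrite sintegral_content_indic measure0.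
by rewrite -(fineK (sintegral_fin_num PT (s n))) -EFinD lee_fin; lra.
Qed.

Lemma fa_expectation_indic (A : set T) : measurable A ->
  fa_expectation P \1_A = P A.
Proof.
move=> mA; pose s : {sfun T >-> R} := indic_sfun _ mA.
rewrite (@cvg_sfun_unique _ (fun=> s) (fine (P A))).
- by rewrite fineK// fin_P.
- exact: bounded_mfun_indic.
- by move=> e e0; apply: nearW => n x; rewrite subrr normr0.
- by rewrite sintegral_content_indic; exact: cvg_cst.
Qed.

End content_expectation.

(** * Classes of bounded functions and positive functionals *)

Section Linfty_ae.
Context d (T : measurableType d) (R : realType) (P0 : probability T R).
Implicit Types (X Y : Linfty P0) (f : T -> R).

Lemma bounded_in_Lfun f : bounded_mfun f ->
  f \in Lfun P0 +oo%E.
Proof.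
move=> [mf /bounded_fun_normP[M fM]]; apply/andP; split.
  by rewrite inE.
rewrite inE /= /finite_norm unlock /Lnorm /= probability_setT lte01.
apply: (@le_lt_trans _ _ M%:E); last exact: ltry.
by apply/ess_supP; apply: nearW => x /=; rewrite lee_fin.
Qed.

(** A total function on functions, equal to zero outside of [Lfun P0 +oo], so
    that no proof of membership has to be carried along. *)
Definition Linfty_class f : Linfty P0 :=
  if pselect (f \in Lfun P0 +oo%E) is left fP
  then Lclass (Lfun_Sub (leey 1%:E) fP) else 0.

Lemma Linfty_classE f : bounded_mfun f ->
  \forall x \ae P0, Linfty_class f x = f x.
Proof.
move=> bf; rewrite /Linfty_class.
case: pselect => [fP|/(_ (bounded_in_Lfun bf))//].
by apply: filterS (LclassE (Lfun_Sub (leey 1%:E) fP)) => x; exact.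
Qed.

Lemma Linfty_linE (a : R) X Y :
  \forall x \ae P0, (a *: X + Y : Linfty P0) x = a * X x + Y x.
Proof.
have h1 := LclassE (Lspace_repr (a *: X) + Lspace_repr Y).
have h2 := LclassE (a *: Lspace_repr X).
apply: filterS2 h1 h2 => x /(_ I) h1 /(_ I) h2.
exact: etrans h1 (congr1 (+%R^~ (Y x)) h2).
Qed.

Lemma Linfty_eqP X Y : (\forall x \ae P0, X x = Y x) -> X = Y.
Proof. by move=> XY; apply/Lspace_eqP; apply: filterS XY => x ->. Qed.

Lemma Linfty_measurable X : measurable_fun setT (X : T -> R).
Proof. exact: (Lfun_measurableTypeR (Lspace_repr X)). Qed.

Lemma Linfty_ae_le_norm X : \forall x \ae P0, `|X x| <= `|X|.
Proof.
apply: filterS2 (ess_sup_ge P0 (EFin \o X)) (ess_sup_ge P0 (EFin \o (\- X))).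
move=> x /= h1 h2; have E := Linfty_normE X.
rewrite ler_norml lerNl -!lee_fin E !le_max h1 /=.
by move: h2; rewrite EFinN => ->; rewrite orbT.
Qed.

Lemma Linfty_norm_le X (c : R) : (\forall x \ae P0, `|X x| <= c) -> `|X| <= c.
Proof.
move=> Xc; rewrite -lee_fin Linfty_normE ge_max.
apply/andP; split; apply/ess_supP.
  by apply: filterS Xc => x /=; rewrite ler_norml lee_fin => /andP[].
by apply: filterS Xc => x /=; rewrite ler_norml lee_fin lerNl => /andP[].
Qed.

End Linfty_ae.

Section functionals.
Context d (T : measurableType d) (R : realType) (P0 : probability T R).
Local Notation V := (Linfty P0).
Implicit Types (X Y : V) (f g : T -> R) (A : set T).

Lemma Linfty0E : \forall x \ae P0, (0 : V) x = 0.
Proof.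
by apply: filterS (LclassE (0 : LfunType P0 (leey 1%:E))) => x; exact.
Qed.

Lemma LinftyZE (a : R) X : \forall x \ae P0, (a *: X : V) x = a * X x.
Proof.
have := Linfty_linE a X 0; rewrite addr0 => h.
by apply: filterS2 h Linfty0E => x -> ->; rewrite addr0.
Qed.

Lemma LinftyBE X Y : \forall x \ae P0, (X - Y : V) x = X x - Y x.
Proof.
have := Linfty_linE (-1) Y X; rewrite scaleN1r addrC.
by apply: filterS => x ->; rewrite mulN1r addrC.
Qed.

Lemma Linfty_class_lin (a : R) f g : bounded_mfun f -> bounded_mfun g ->
  Linfty_class P0 (fun x => a * f x + g x) =
  a *: Linfty_class P0 f + Linfty_class P0 g.
Proof.
move=> bf bg; apply: Linfty_eqP; have bh := bounded_mfun_lin a bf bg.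
have h := Linfty_linE a (Linfty_class P0 f) (Linfty_class P0 g).
have h' : \forall x \ae P0,
    Linfty_class P0 f x = f x /\ Linfty_class P0 g x = g x.
  by apply: filterI; exact: Linfty_classE.
by apply: filterS3 h (Linfty_classE P0 bh) h' => x -> -> [-> ->].
Qed.

Definition positive_functional (phi : {scalar V}) :=
  forall X, Linfty_ge0 P0 X -> 0 <= phi X.

Section positive.
Variable phi : {scalar V}.
Hypothesis phi_ge0 : positive_functional phi.

Lemma positive_functional_le X Y : (\forall x \ae P0, X x <= Y x) ->
  phi X <= phi Y.
Proof.
move=> XY; rewrite -subr_ge0 -linearB; apply: phi_ge0.
by apply: filterS2 XY (LinftyBE Y X) => x h ->; rewrite subr_ge0.
Qed.

(** Both [X] and [- X] are almost everywhere at most the constant [`|X|]. *)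
Lemma positive_functional_norm X :
  `|phi X| <= phi (Linfty_class P0 (cst 1)) * `|X|.
Proof.
have h1 := LinftyZE `|X| (Linfty_class P0 (cst 1)).
have h2 : \forall x \ae P0, `|X x| <= `|X| /\ Linfty_class P0 (cst 1) x = 1.
  apply: filterI; first exact: Linfty_ae_le_norm.
  exact: Linfty_classE (@bounded_mfun_cst _ T R 1).
rewrite ler_norml lerNl -linearN mulrC -linearZ/=; apply/andP; split;
  apply: positive_functional_le.
  have h3 := LinftyZE (-1) X; rewrite scaleN1r in h3.
  apply: filterS3 h1 h2 h3 => x -> [+ ->] ->.
  by rewrite ler_norml mulN1r /= mulr1 lerNl => /andP[].
apply: filterS2 h1 h2 => x -> [+ ->].
by rewrite ler_norml /= mulr1 => /andP[].
Qed.

End positive.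

(** If every event [n.+1%:R^-1 <= X] were null, so would be their union, which
    is [0 < X]. *)
Lemma Linfty_indic_gt0 X : Linfty_ge0 P0 X -> X != 0 -> exists e A,
  [/\ 0 < e, measurable A, (0 < P0 A)%E &
      \forall x \ae P0, (e *: Linfty_class P0 \1_A : V) x <= X x].
Proof.
move=> X0 /eqP X_neq0; apply: contrapT => no; apply: X_neq0.
have mX := Linfty_measurable X.
pose A n := [set x | n.+1%:R^-1 <= X x].
have mA n : measurable (A n).
  by rewrite -[A n]setTI; apply: measurable_fun_le.
have A0 n : P0 (A n) = 0%E.
  apply/eqP; rewrite eq_le measure_ge0 andbT leNgt; apply/negP => An.
  apply: no; exists n.+1%:R^-1, (A n); split=> //.
  have h1 := LinftyZE n.+1%:R^-1 (Linfty_class P0 \1_(A n)).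
  have h2 := Linfty_classE P0 (bounded_mfun_indic R (mA n)).
  apply: filterS3 h1 h2 X0 => x -> -> Xx; rewrite indicE.
  by have [/set_mem|_] := boolP (x \in A n); rewrite ?mulr1// mulr0.
have : P0.-negligible (\bigcup_n A n).
  by apply: negligible_bigcup => n; exists (A n); split=> //; exact: A0.
move=> NA; apply: Linfty_eqP.
have h : \forall x \ae P0, ~ (\bigcup_n A n) x.
  by apply: negligibleS NA => x /= /contrapT.
apply: filterS3 h X0 Linfty0E => x nAx Xx ->; apply/eqP; rewrite eq_le Xx andbT.
rewrite leNgt; apply/negP => Xx0; apply: nAx.
have y0 : 0 < (X x : R) by [].
have [n _ nX] := near_infty_natSinv_lt (PosNum y0).
by exists n => //; apply: ltW; exact: nX n (leqnn n).
Qed.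

End functionals.

(** * Martingale probabilities and their functionals *)

Section fap_functional.
Context d (T : measurableType d) (R : realType) (P0 : probability T R).
Local Notation V := (Linfty P0).
Implicit Types (X Y : V) (f g : T -> R) (A : set T).

Definition martingale_functional (L : set {RV P0 >-> R}) (phi : {scalar V}) :=
  [/\ positive_functional phi,
      forall A, measurable A -> (0 < P0 A)%E -> 0 < phi (Linfty_class P0 \1_A) &
      forall X, Linfty_image L X -> phi X = 0].

Section fap_to_functional.
Variable P : {content set T -> \bar R}.
Hypothesis PT : P setT = 1%E.
Hypothesis PP0 : forall A, measurable A -> P A = 0%E <-> P0 A = 0%E.
Local Notation E f := (fine (fa_expectation P f)).

Lemma ae_fa_expectation_ge0 f :
    bounded_mfun f -> (\forall x \ae P0, 0 <= f x) ->
  0 <= E f.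
Proof.
move=> bf f0; pose N := ~` [set x | 0 <= f x].
have mN : measurable N.
  apply: measurableC; rewrite -[X in measurable X]setTI.
  by apply: measurable_fun_le => //; exact: bf.1.
have PN : P N = 0%E.
  by apply/(PP0 mN)/(negligibleP P0 mN).
have [M fM] := (bounded_fun_normP f).1 bf.2.
(* adding a large multiple of the indicator of a null set makes [f] nonnegative
   everywhere without changing its expectation *)
have := fa_expectation_lin PT M (bounded_mfun_indic R mN) bf.
rewrite fa_expectation_indic// PN mulr0 add0r => <-.
apply: fa_expectation_ge0 => //.
  by apply: bounded_mfun_lin => //; exact: bounded_mfun_indic.
move=> x; rewrite indicE.
have [/set_mem _|/negP xN] := boolP (x \in N).
  by have := fM x; rewrite mulr1 ler_norml => /andP[]; lra.
rewrite mulr0 add0r; apply: contrapT => fx; apply: xN; exact: mem_set.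
Qed.

Lemma ae_fa_expectation_eq f g : bounded_mfun f -> bounded_mfun g ->
  (\forall x \ae P0, f x = g x) -> E f = E g.
Proof.
move=> bf bg fg.
have fgN h k : bounded_mfun h -> bounded_mfun k ->
    (\forall x \ae P0, h x = k x) -> E h <= E k.
  move=> bh bk hk; have : 0 <= E (fun x => -1 * h x + k x).
    apply: ae_fa_expectation_ge0; first exact: bounded_mfun_lin.
    by apply: filterS hk => x ->; rewrite mulN1r addNr.
  by rewrite fa_expectation_lin//; lra.
apply/eqP; rewrite eq_le !fgN//.
by apply: filterS fg => x ->.
Qed.

(** The expectation is meaningful for bounded functions, while an element of
    [Linfty P0] is only essentially bounded: it is set to zero on the null set
    where it exceeds its norm. *)
Definition bounded_repr X (x : T) : R :=
  X x * \1_[set x | `|X x| <= `|X|] x.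

Lemma bounded_mfun_repr X : bounded_mfun (bounded_repr X).
Proof.
have mX := Linfty_measurable X; split.
  apply: measurable_funM => //; apply: measurable_indic.
  rewrite -[X in measurable X]setTI; apply: measurable_fun_le => //.
  exact: measurableT_comp.
apply/bounded_fun_normP; exists `|X| => x; rewrite /bounded_repr indicE.
by have [/set_mem|] := boolP (x \in _); rewrite ?mulr1// mulr0 normr0.
Qed.

Lemma bounded_reprE X : \forall x \ae P0, bounded_repr X x = X x.
Proof.
apply: filterS (Linfty_ae_le_norm X) => x Xx; rewrite /bounded_repr indicE.
by rewrite mem_set// mulr1.
Qed.

Lemma fap_functional : exists2 phi : {scalar V}, positive_functional phi &
  forall f, bounded_mfun f -> phi (Linfty_class P0 f) = E f.
Proof.
pose p X := E (bounded_repr X).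
have plin : linear_for *%R p.
  move=> a X Y; rewrite /p -fa_expectation_lin//; try exact: bounded_mfun_repr.
  apply: ae_fa_expectation_eq; first exact: bounded_mfun_repr.
    by apply: bounded_mfun_lin; exact: bounded_mfun_repr.
  have h : \forall x \ae P0, bounded_repr X x = X x /\ bounded_repr Y x = Y x.
    by apply: filterI; exact: bounded_reprE.
  have h' := bounded_reprE (a *: X + Y).
  by apply: filterS3 h h' (Linfty_linE a X Y) => x [-> ->] -> ->.
pose pL := GRing.isLinear.Build _ _ _ _ p plin.
pose phi : {scalar V} := HB.pack p pL.
exists phi => [X X0|f bf].
  apply: ae_fa_expectation_ge0; first exact: bounded_mfun_repr.
  by apply: filterS2 X0 (bounded_reprE X) => x + ->.
apply: ae_fa_expectation_eq => //; first exact: bounded_mfun_repr.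
have h := bounded_reprE (Linfty_class P0 f).
by apply: filterS2 h (Linfty_classE P0 bf) => x -> ->.
Qed.

End fap_to_functional.

Lemma equiv_martingale_fap_functional (L : set {RV P0 >-> R})
    (L_bounded : forall X : {RV P0 >-> R}, L X ->
      bounded_fun (X : T -> R)) P :
  equiv_martingale_fap L P -> exists phi, martingale_functional L phi.
Proof.
move=> [PT PP0 PL]; have [phi phi_ge0 phiE] := fap_functional PT PP0.
exists phi; split=> // [A mA A0|Y [X LX YX]].
  have bA := bounded_mfun_indic R mA.
  rewrite phiE// fa_expectation_indic// fine_gt0// ltey_eq fin_P// andbT.
  rewrite lt0e measure_ge0 andbT; apply/eqP => /(PP0 _ mA) PA.
  by rewrite PA ltxx in A0.
have bX : bounded_mfun X by split=> //; exact: L_bounded.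
have -> : Y = Linfty_class P0 X.
  apply: Linfty_eqP.
  by apply: filterS2 YX (Linfty_classE P0 bX) => x /(_ I) -> ->.
by rewrite phiE// PL.
Qed.

End fap_functional.

Section functional_fap.
Context d (T : measurableType d) (R : realType) (P0 : probability T R).
Local Notation V := (Linfty P0).
Implicit Types (X Y : V) (f g : T -> R) (A : set T).
Import HBSimple.

Lemma ge0_Linfty_class_indic A : Linfty_ge0 P0 (Linfty_class P0 \1_A).
Proof.
rewrite /Linfty_class; case: pselect => [fP|_].
  apply: filterS (LclassE (Lfun_Sub (leey 1%:E) fP)) => x /(_ I) ->.
  by rewrite Lfun_valP indicE.
by apply: filterS (Linfty0E P0) => x ->.
Qed.

Lemma linear_sfun (phi : {scalar V}) (s : {sfun T >-> R}) :
  phi (Linfty_class P0 s) = \sum_(a <- fset_set (range s))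
    a * phi (Linfty_class P0 \1_(s @^-1` [set a])).
Proof.
have sE : (s : T -> R) = fun x => \sum_(a <- fset_set (range s))
    a * \1_(s @^-1` [set a]) x.
  by apply/funext => x; rewrite {1}fimfunE fsbig_finite//; exact: fimfunP.
rewrite {1}sE; move: (fset_set (range s) : seq R) => r.
have c0 : Linfty_class P0 (cst 0) = 0.
  have b0 := @bounded_mfun_cst _ T R 0.
  apply: Linfty_eqP.
  by apply: filterS2 (Linfty_classE P0 b0) (Linfty0E P0) => x -> ->.
suff [] : bounded_mfun (fun x => \sum_(a <- r) a * \1_(s @^-1` [set a]) x) /\
    phi (Linfty_class P0 (fun x => \sum_(a <- r) a * \1_(s @^-1` [set a]) x)) =
    \sum_(a <- r) a * phi (Linfty_class P0 \1_(s @^-1` [set a])) by [].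
elim: r => [|a r [br IH]].
  under eq_fun do rewrite big_nil; rewrite big_nil.
  by split; [exact: bounded_mfun_cst|rewrite c0 linear0].
have ba : bounded_mfun (\1_(s @^-1` [set a]) : T -> R).
  exact: bounded_mfun_indic.
under eq_fun do rewrite big_cons; rewrite big_cons; split.
  exact: bounded_mfun_lin.
by rewrite Linfty_class_lin// linearP IH.
Qed.

Section content_of_functional.
Variable phi : {scalar V}.
Hypothesis phi_ge0 : positive_functional phi.
Hypothesis phi1 : phi (Linfty_class P0 (cst 1)) = 1.

Definition functional_content A : \bar R := (phi (Linfty_class P0 \1_A))%:E.

Let functional_content_ge0 A : (0 <= functional_content A)%E.
Proof. by rewrite lee_fin; apply/phi_ge0/ge0_Linfty_class_indic. Qed.

Let functional_content0 : functional_content set0 = 0%E.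
Proof.
rewrite /functional_content (_ : Linfty_class P0 \1_set0 = 0) ?linear0//.
have b0 := bounded_mfun_indic R (@measurable0 _ T).
apply: Linfty_eqP.
apply: filterS2 (Linfty_classE P0 b0) (Linfty0E P0) => x -> ->.
by rewrite indicE in_set0.
Qed.

Let functional_content_additive :
  measure_function.semi_additive functional_content.
Proof.
apply/(additive2P functional_content0) => A B mA mB AB0.
have bA := bounded_mfun_indic R mA; have bB := bounded_mfun_indic R mB.
rewrite /functional_content.
have <- : (fun x => 1 * \1_A x + \1_B x : R) = \1_(A `|` B).
  apply/funext => x; rewrite mul1r !indicE in_setU.
  have [/set_mem xA|xA] := boolP (x \in A);
    have [/set_mem xB|xB] := boolP (x \in B).
  - by have : (A `&` B) x by []; rewrite AB0.
  - by rewrite addr0.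
  - by rewrite add0r.
  - by rewrite addr0.
by rewrite Linfty_class_lin// scale1r linearD EFinD.
Qed.

HB.instance Definition _ := isContent.Build _ _ _ functional_content
  functional_content_ge0 functional_content_additive.

(** The content structure depends on [phi_ge0], so that its bundled form has to
    be named for use with a given functional. *)
Definition functional_fap : {content set T -> \bar R} := functional_content.

Lemma functional_fapE A : functional_fap A = (phi (Linfty_class P0 \1_A))%:E.
Proof. by []. Qed.

Lemma functional_fapT : functional_fap setT = 1%E.
Proof. by rewrite functional_fapE indicT phi1. Qed.

(** Both sides agree on simple functions. The right-hand side is continuous for
    the norm, hence for uniform convergence, and the left-hand side is defined
    as a uniform limit. *)
Lemma fa_expectation_functional f : bounded_mfun f ->
  fa_expectation functional_fap f = (phi (Linfty_class P0 f))%:E.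
Proof.
move=> bf; have [s sf] := sfun_dense bf.1 bf.2.
have {}sf := (cvg_uniformP _ _).1 sf.
have sphi (t : {sfun T >-> R}) :
    fine (sintegral functional_fap t) = phi (Linfty_class P0 t).
  rewrite linear_sfun /sintegral -(fsbig_widen (range t))//=; last first.
    by move=> a [_ Nta] /=; rewrite preimage10// measure0 mule0.
  rewrite fsbig_finite; last exact: fimfunP.
  under eq_bigr do rewrite functional_fapE -EFinM.
  by rewrite sumEFin.
apply: (cvg_sfun_unique functional_fapT bf sf).
apply/cvgrPdist_le => e e0; apply: filterS (sf _ e0) => n fn.
rewrite sphi -linearB (le_trans (positive_functional_norm phi_ge0 _))//.
rewrite phi1 mul1r; apply: Linfty_norm_le.
have h := LinftyBE (Linfty_class P0 f) (Linfty_class P0 (s n)).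
have bs := bounded_mfun_sfun (s n).
apply: filterS3 h (Linfty_classE P0 bf) (Linfty_classE P0 bs) => x -> -> ->.
by rewrite ltW.
Qed.

End content_of_functional.

Lemma martingale_functional_fap (L : set {RV P0 >-> R})
    (L_bounded : forall X : {RV P0 >-> R}, L X ->
      bounded_fun (X : T -> R)) phi :
  martingale_functional L phi ->
  exists P : {content set T -> \bar R}, equiv_martingale_fap L P.
Proof.
move=> [phi_ge0 phi_gt0 phiL].
pose c := phi (Linfty_class P0 (cst 1)).
have c0 : 0 < c.
  by rewrite /c -(@indicT T R); apply: phi_gt0 => //; rewrite probability_setT.
have [psi psiE] := scale_functional c^-1 phi.
have psi_ge0 : positive_functional psi.
  move=> X X0; rewrite psiE; apply: mulr_ge0; last exact: phi_ge0.
  by rewrite invr_ge0 ltW.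
have psi1 : psi (Linfty_class P0 (cst 1)) = 1 by rewrite psiE mulVf// gt_eqF.
exists (functional_fap psi_ge0); split=> [|A mA|X LX].
- exact: functional_fapT.
- have bA := bounded_mfun_indic R mA.
  rewrite functional_fapE psiE; split=> [[/eqP]|PA].
    rewrite mulf_eq0 invr_eq0 gt_eqF//= => /eqP phiA.
    apply/eqP; rewrite eq_le measure_ge0 andbT leNgt.
    by apply/negP => /(phi_gt0 _ mA); rewrite phiA ltxx.
  rewrite (_ : Linfty_class P0 \1_A = 0) ?linear0 ?mulr0//.
  have nA : \forall x \ae P0, ~ A x.
    by exists A; split=> // x /= /contrapT.
  apply: Linfty_eqP.
  apply: filterS3 nA (Linfty_classE P0 bA) (Linfty0E P0) => x nAx -> ->.
  by rewrite indicE memNset.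
- have bX : bounded_mfun X by split=> //; exact: L_bounded.
  rewrite fa_expectation_functional// psiE phiL ?mulr0//.
  by exists X => //; apply: filterS (Linfty_classE P0 bX) => x ->.
Qed.

End functional_fap.

(** * Functionals separating from the cone of differences *)

Section separating_functionals.
Context d (T : measurableType d) (R : realType) (P0 : probability T R).
Variable L : set {RV P0 >-> R}.
Hypothesis L_linear : submod_closed [in L].
Local Notation V := (Linfty P0).
Local Notation K := (set_sub (Linfty_image L) (Linfty_ge0 P0)).
Implicit Types (X Y : V) (A : set T).

Lemma Linfty_image0 : Linfty_image L 0.
Proof.
exists 0; first exact: set_mem L_linear.1.
by apply: filterS (Linfty0E P0) => x ->.
Qed.

Lemma Linfty_image_lin (a : R) X Y : Linfty_image L X -> Linfty_image L Y ->
  Linfty_image L (a *: X + Y).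
Proof.
move=> [f Lf Xf] [g Lg Yg]; exists (a *: f + g).
  by apply: set_mem; apply: L_linear.2; exact: mem_set.
by apply: filterS3 Xf Yg (Linfty_linE a X Y) => x /(_ I) -> /(_ I) -> ->.
Qed.

Lemma Linfty_ge0_0 : Linfty_ge0 P0 0.
Proof. by apply: filterS (Linfty0E P0) => x ->. Qed.

Lemma Linfty_ge0_lin (a : R) X Y : 0 <= a -> Linfty_ge0 P0 X ->
  Linfty_ge0 P0 Y -> Linfty_ge0 P0 (a *: X + Y).
Proof.
move=> a0 X0 Y0; apply: filterS3 X0 Y0 (Linfty_linE a X Y) => x x0 y0 ->.
by rewrite addr_ge0// mulr_ge0.
Qed.

Lemma convex_cone_set_sub : convex_cone K.
Proof.
split=> [|_ _ [X LX [Y Y0 <-]] [X' LX' [Y' Y'0 <-]]|a _ a0 [X LX [Y Y0 <-]]].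
- exists 0; first exact: Linfty_image0.
  by exists 0; [exact: Linfty_ge0_0|rewrite subr0].
- exists (1 *: X + X'); first exact: Linfty_image_lin.
  exists (1 *: Y + Y'); first exact: Linfty_ge0_lin.
  by rewrite !scale1r addrACA opprD.
- exists (a *: X + 0).
    by apply: Linfty_image_lin => //; exact: Linfty_image0.
  exists (a *: Y + 0).
    by apply: Linfty_ge0_lin; [exact: ltW|by []|exact: Linfty_ge0_0].
  by rewrite !addr0 scalerBr.
Qed.

(** The cone contains the negative classes, as well as [X] and [- X] for each
    [X] in [L]. *)
Lemma cone_nonpos_functional (phi : {scalar V}) :
    (forall X, K X -> phi X <= 0) ->
  positive_functional phi /\ forall X, Linfty_image L X -> phi X = 0.
Proof.
move=> phiK; split=> [X X0|X LX].
  rewrite -oppr_le0 -linearN; apply: phiK; exists 0; first exact: Linfty_image0.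
  by exists X; rewrite ?sub0r.
have phi_le0 Y : Linfty_image L Y -> phi Y <= 0.
  move=> LY; apply: phiK; exists Y => //.
  by exists 0; [exact: Linfty_ge0_0|rewrite subr0].
apply/eqP; rewrite eq_le phi_le0//= -oppr_le0 -linearN phi_le0//.
rewrite -[- X]addr0 -scaleN1r.
by apply: Linfty_image_lin => //; exact: Linfty_image0.
Qed.

Lemma martingale_functional_nonpos phi X : martingale_functional L phi -> K X ->
  phi X <= 0.
Proof.
move=> [phi_ge0 _ phiL] [Y LY [Z Z0 <-]].
by rewrite linearB (phiL _ LY) sub0r oppr_le0; exact: phi_ge0.
Qed.

Lemma martingale_functional_gt0 phi X : martingale_functional L phi ->
  Linfty_ge0 P0 X -> X != 0 -> 0 < phi X.
Proof.
move=> [phi_ge0 phi_gt0 _] X0 X_neq0.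
have [e [A [e0 mA A0 eAX]]] := Linfty_indic_gt0 X0 X_neq0.
apply: lt_le_trans (positive_functional_le phi_ge0 eAX).
by rewrite linearZ mulr_gt0//; exact: phi_gt0.
Qed.

Lemma Linfty_class_indic_neq0 A : measurable A -> (0 < P0 A)%E ->
  Linfty_class P0 \1_A != 0.
Proof.
move=> mA A0; apply/eqP => A_eq0; have bA := bounded_mfun_indic R mA.
have : \forall x \ae P0, ~ A x.
  have := Linfty_classE P0 bA; rewrite A_eq0 => h.
  apply: filterS2 h (Linfty0E P0) => x -> /eqP + Ax.
  by rewrite indicE mem_set// oner_eq0.
move=> [B [mB B0 AB]]; have : (P0 A <= P0 B)%E.
  by apply: le_measure; rewrite ?inE// => x Ax; apply: AB => /(_ Ax).
by rewrite B0 leNgt A0.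
Qed.

Lemma positive_functional_open (phi : {scalar V}) : positive_functional phi ->
  open [set X | 0 < phi X].
Proof.
move=> phi_ge0; rewrite openE => X /= X0; apply/nbhs_ballP.
pose c := phi (Linfty_class P0 (cst 1)) + 1.
have c0 : 0 < c.
  rewrite ltr_wpDl//; apply/phi_ge0.
  by rewrite -indicT; exact: ge0_Linfty_class_indic.
exists (phi X / c) => /=; first by rewrite divr_gt0.
move=> Y; rewrite -ball_normE /= ltr_pdivlMr// => XY.
have : `|phi (X - Y)| < phi X.
  rewrite (le_lt_trans (positive_functional_norm phi_ge0 _))//.
  by apply: le_lt_trans XY; rewrite mulrC ler_wpM2l// lerDl.
by rewrite linearB ltr_distl/= => /andP[_]; lra.
Qed.

Lemma martingale_functional_convex_open phi : martingale_functional L phi ->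
  exists U : set V, [/\ open U, convex_set U, Linfty_ge0 P0 `<=` U `|` [set 0] &
    K `&` U = set0].
Proof.
move=> mphi; exists [set X | 0 < phi X]; split.
- by apply: positive_functional_open; case: mphi.
- apply/convex_setP => X Y a b a0 b0 _ X0 Y0 /=.
  by rewrite linearD !linearZ addr_gt0// mulr_gt0.
- move=> X X0; have [->|X_neq0] := eqVneq X 0; first by right.
  by left; exact: martingale_functional_gt0.
- rewrite -subset0 => X [/(martingale_functional_nonpos mphi) X0 /=].
  by rewrite ltNge X0.
Qed.

Lemma convex_open_martingale_functional (U : set V) :
    open U -> convex_set U -> Linfty_ge0 P0 `<=` U `|` [set 0] ->
    K `&` U = set0 ->
  exists phi, martingale_functional L phi.
Proof.
move=> oU cU geU KU0.
have U_indic A : measurable A -> (0 < P0 A)%E -> U (Linfty_class P0 \1_A).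
  move=> mA A0; have [//|A_eq0] := geU _ (ge0_Linfty_class_indic P0 A).
  by have /eqP := Linfty_class_indic_neq0 mA A0.
have [||phi [phiU phiK]] :=
    exists_separating_functional oU cU convex_cone_set_sub.
- exists (Linfty_class P0 \1_setT).
  by apply: U_indic; rewrite ?probability_setT.
- by rewrite setIC.
have [phi_ge0 phiL] := cone_nonpos_functional phiK.
by exists phi; split=> // A mA A0; exact/phiU/U_indic.
Qed.

Lemma disjoint_open_closure (U : set V) :
    open U -> Linfty_ge0 P0 `<=` U `|` [set 0] -> K `&` U = set0 ->
  closure K `&` Linfty_ge0 P0 = [set 0].
Proof.
move=> oU geU KU0; apply/seteqP; split=> [X [KX X0]|_ ->].
  have [UX|//] := geU _ X0.
  have /set0P := KX U (open_nbhs_nbhs (conj oU UX)).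
  by rewrite KU0 eqxx.
split; last exact: Linfty_ge0_0.
by apply: subset_closure; case: convex_cone_set_sub.
Qed.

(** A point outside of the closure of [K] has a ball disjoint from [K]; the ball
    is open and convex. *)
Lemma closure_separating_functional X : closure K `&` Linfty_ge0 P0 = [set 0] ->
    Linfty_ge0 P0 X -> X != 0 ->
  exists phi : {scalar V}, [/\ positive_functional phi,
    forall Y, Linfty_image L Y -> phi Y = 0 & 0 < phi X].
Proof.
move=> K0 X0 X_neq0.
have : ~ closure K X.
  by move=> KX; move/eqP : X_neq0; apply; have : [set 0] X by rewrite -K0.
move=> /existsNP[B /not_implyP[/nbhs_ballP[r /= r0 rB] KB]].
have oX : open (ball X r) by exact: ball_open.
have [||phi [phiX phiK]] :=
    exists_separating_functional oX (@convex_set_ball _ _ X r)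
      convex_cone_set_sub.
- by exists X; exact: ballxx.
- rewrite -subset0 => Y [XY KY]; apply: KB; exists Y; split=> //; exact: rB.
have [phi_ge0 phiL] := cone_nonpos_functional phiK.
by exists phi; split=> //; apply/phiX/ballxx.
Qed.

(** The bound on the values at the constant class [1] makes the series of the
    [phi n X / 2 ^+ n] converge absolutely for each [X], by comparison with
    [`|X| / 2 ^+ n]. *)
Lemma positive_functional_series (phi : nat -> {scalar V}) :
    (forall n, positive_functional (phi n)) ->
    (forall n, phi n (Linfty_class P0 (cst 1)) <= 1) ->
  exists psi : {scalar V}, [/\ positive_functional psi,
    forall X, (forall n, phi n X = 0) -> psi X = 0 &
    forall n X, Linfty_ge0 P0 X -> 0 < phi n X -> 0 < psi X].
Proof.
move=> phi_ge0 phi1.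
pose u X : R^nat := fun n => phi n X / 2 ^+ n.
have cu X : cvgn (series (u X)).
  apply: normed_cvg; apply: (@series_le_cvg _ _ (geometric `|X| 2^-1)).
  - by move=> n /=.
  - by move=> n; rewrite /= mulr_ge0// exprn_ge0.
  - move=> n; rewrite /= /u normrM [X in _ * X]ger0_norm ?invr_ge0 ?exprn_ge0//.
    rewrite exprVn ler_wpM2r ?invr_ge0 ?exprn_ge0//.
    rewrite (le_trans (positive_functional_norm (phi_ge0 n) X))//.
    by rewrite -[leRHS]mul1r ler_wpM2r.
  - by apply: is_cvg_geometric_series; rewrite ger0_norm; lra.
pose p X := limn (series (u X)).
have plin : linear_for *%R p.
  move=> a X Y; apply/cvg_lim => //.
  rewrite (_ : series _ = fun n => a * series (u X) n + series (u Y) n).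
    by apply: cvgD; [apply: cvgMr; exact: cu|exact: cu].
  apply/funext => n; rewrite !seriesEnat/= mulr_sumr -big_split/=.
  by apply: eq_bigr => k _; rewrite /u linearP/= mulrDl -mulrA.
pose pL := GRing.isLinear.Build _ _ _ _ p plin.
pose psi : {scalar V} := HB.pack p pL.
have u_le n X : Linfty_ge0 P0 X -> u X n <= p X.
  move=> X0; have u0 k : 0 <= u X k.
    by rewrite divr_ge0 ?exprn_ge0//; exact: phi_ge0.
  have ndu : {homo series (u X) : m k / (m <= k)%N >-> m <= k}.
    by apply: nondecreasing_series.
  apply: le_trans (nondecreasing_cvgn_le ndu (cu X) n.+1).
  rewrite seriesSr lerDr; exact: sumr_ge0.
exists psi; split=> [X X0|X phiX|n X X0 phiX].
- apply: le_trans (u_le 0%N X X0).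
  by rewrite divr_ge0 ?exprn_ge0//; exact: phi_ge0.
- rewrite /= /p (_ : u X = 0); last by apply/funext => n; rewrite /u phiX mul0r.
  rewrite seriesEnat; apply/cvg_lim => //=; under eq_fun do rewrite big1//.
  exact: cvg_cst.
- by apply: lt_le_trans (u_le n X X0); rewrite divr_gt0 ?exprn_gt0.
Qed.

Lemma atomic_martingale_functional : is_atomic P0 ->
    closure K `&` Linfty_ge0 P0 = [set 0] ->
  exists phi, martingale_functional L phi.
Proof.
move=> [D [A [[coverA _ _] atomA]]] K0.
have one_ge0 : Linfty_ge0 P0 (Linfty_class P0 (cst 1)).
  by rewrite -indicT; exact: ge0_Linfty_class_indic.
have /choice[phi phiP] n : exists phi : {scalar V}, [/\ positive_functional phi,
    forall Y, Linfty_image L Y -> phi Y = 0,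
    phi (Linfty_class P0 (cst 1)) <= 1 &
    D n -> 0 < phi (Linfty_class P0 \1_(A n))].
  have [Dn|nDn] := pselect (D n); last first.
    by exists \0; split.
  have [mA A0 _] := atomA n Dn.
  have [phi [phi_ge0 phiL phiA]] := closure_separating_functional K0
    (ge0_Linfty_class_indic P0 (A n)) (Linfty_class_indic_neq0 mA A0).
  (* adding 1 avoids having to know that [phi] is nonzero at the class of 1 *)
  pose c := phi (Linfty_class P0 (cst 1)) + 1.
  have c0 : 0 < c by rewrite ltr_wpDl//; exact: phi_ge0.
  have [psi psiE] := scale_functional c^-1 phi.
  exists psi; split=> [X X0|X LX||_]; rewrite psiE.
  - by rewrite mulr_ge0 ?invr_ge0 ?(ltW c0)//; exact: phi_ge0.
  - by rewrite phiL// mulr0.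
  - by rewrite ler_pdivrMl// mulr1 lerDl.
  - by rewrite mulr_gt0 ?invr_gt0.
have [||psi [psi_ge0 psi0 psi_gt0]] := @positive_functional_series phi.
- by move=> n; case: (phiP n).
- by move=> n; case: (phiP n).
exists psi; split=> // [B mB B0|X LX]; last first.
  by apply: psi0 => n; case: (phiP n) => _ + _ _; exact.
(* an event of positive probability meets some atom in positive probability,
   and then contains this atom up to a null set *)
have [n Dn ABn] : exists2 n, D n & (0 < P0 (B `&` A n))%E.
  apply: contrapT => noA.
  have : P0.-negligible B.
    have -> : B = \bigcup_n (if pselect (D n) then B `&` A n else set0).
      apply/seteqP; split=> [x Bx|x [n _]]; last by case: pselect => // _ [].
      have [n Dn Anx] : (\bigcup_(n in D) A n) x.
        by rewrite -/(cover D A) coverA.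
      by exists n => //; case: pselect.
    apply: negligible_bigcup => n.
    case: pselect => Dn; last exact: negligible_set0.
    have [mA _ _] := atomA n Dn.
    exists (B `&` A n); split=> //; first exact: measurableI.
    apply/eqP; rewrite eq_le measure_ge0 andbT leNgt; apply/negP => h.
    by apply: noA; exists n.
  move=> [C [mC C0 BC]]; have : (P0 B <= P0 C)%E by rewrite le_measure ?inE.
  by rewrite C0 leNgt B0.
have [mA A0 atomAB] := atomA n Dn.
have finP C : measurable C -> P0 C = (fine (P0 C))%:E.
  by move=> mC; rewrite fineK// fin_num_measure.
have PBA : P0 (B `&` A n) = P0 (A n).
  have a0 : 0 < fine (P0 (A n)) by rewrite -lte_fin -finP.
  have := atomAB B mB.
  rewrite /cond_prob (finP _ mA) (finP _ (measurableI _ _ mB mA)).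
  rewrite inver gt_eqF// -EFinM => -[|] [/eqP].
    rewrite mulf_eq0 invr_eq0 (gt_eqF a0) orbF => /eqP b0.
    by move: ABn; rewrite (finP _ (measurableI _ _ mB mA)) b0 ltxx.
  by rewrite -subr_eq0 -(divff (lt0r_neq0 a0)) -mulrBl mulf_eq0 invr_eq0
    (gt_eqF a0) orbF subr_eq0 => /eqP ->.
apply: lt_le_trans (psi_gt0 n _ (ge0_Linfty_class_indic P0 (A n)) _) _.
  by case: (phiP n) => _ _ _; exact.
apply: positive_functional_le => //.
have ABae : \forall x \ae P0, A n x -> B x.
  exists (A n `\` B); split; first exact: measurableD.
    have PAoo : (P0 (A n) < +oo)%E by rewrite ltey_eq fin_num_measure.
    rewrite setIC in PBA.
    apply: etrans (measureD mA mB PAoo) _.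
    apply: etrans (congr1 (fun z => P0 (A n) - z)%E PBA) _.
    by rewrite subee// fin_num_measure.
  by move=> x /= /not_implyP.
have bA := bounded_mfun_indic R mA; have bB := bounded_mfun_indic R mB.
apply: filterS3 ABae (Linfty_classE P0 bA) (Linfty_classE P0 bB) => x AB -> ->.
rewrite !indicE ler_nat; have [/set_mem/AB Bx|//] := boolP (x \in A n).
by rewrite mem_set.
Qed.

End separating_functionals.

Theorem theorem8 (d : measure_display) (T : measurableType d) (R : realType)
    (P0 : probability T R) (L : set {RV P0 >-> R})
    (L_linear : submod_closed [in L])
    (L_bounded : forall X : {RV P0 >-> R}, L X -> bounded_fun (X : T -> R)) :
  [/\ (exists P : {content set T -> \bar R}, equiv_martingale_fap L P) <->
      (exists U : set (Linfty P0),
        [/\ open U, convex_set U,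
            Linfty_ge0 P0 `<=` U `|` [set 0] &
            set_sub (Linfty_image L) (Linfty_ge0 P0) `&` U = set0]),
      (exists P : {content set T -> \bar R}, equiv_martingale_fap L P) ->
        closure (set_sub (Linfty_image L) (Linfty_ge0 P0))
          `&` Linfty_ge0 P0 = [set 0] &
      is_atomic P0 ->
        closure (set_sub (Linfty_image L) (Linfty_ge0 P0))
          `&` Linfty_ge0 P0 = [set 0] ->
        exists P : {content set T -> \bar R}, equiv_martingale_fap L P].
Proof.
have fapP : (exists P : {content set T -> \bar R}, equiv_martingale_fap L P) <->
    exists phi, martingale_functional L phi.
  split=> [[P]|[phi]]; first exact: equiv_martingale_fap_functional.
  exact: martingale_functional_fap.
split.
- rewrite fapP; split=> [[phi]|[U [oU cU geU KU0]]].
    exact: martingale_functional_convex_open.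
  exact: (@convex_open_martingale_functional _ _ _ _ _ L_linear U).
- rewrite fapP => -[phi /martingale_functional_convex_open[U [oU _ geU KU0]]].
  exact: (@disjoint_open_closure _ _ _ _ _ L_linear U).
- by move=> atomP0 K0; apply/fapP; exact: atomic_martingale_functional.
Qed.
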